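(* For any nontrivial connected graphs $G$ and $H$, the exponential graph $G^H$ is maximally connected, i.e., $$\kappa\left(G^H\right)=\delta(G)+\delta(H).$$
   Context: A graph means a finite simple undirected graph with at least one vertex; it is nontrivial if it has at least two vertices. $\delta(G)$ is the minimum degree of $G$. The connectivity $\kappa(G)$ is the minimum number of vertices whose removal from $G$ results in a disconnected graph or a graph with one vertex. A graph $G$ is maximally connected if $\kappa(G)=\delta(G)$. Exponential graph: for graphs $G$ and $H$ with $V(H)=\{w_1,\ldots,w_q\}$, the exponential graph $G^H$ has vertex set $\{(u_1,\ldots,u_q;w_j) : u_i\in V(G)\ (1\le i\le q),\ 1\le j\le q\}$, and two vertices $(u_1,\ldots,u_q;w_j)$ and $(v_1,\ldots,v_q;w_k)$ are adjacent if and only if either ($j=k$, $u_jv_j\in E(G)$, and $u_i=v_i$ for all $i\ne j$) or ($j\neq k$, $w_jw_k\in E(H)$, and $u_i=v_i$ for all $i$). (One has $\delta(G^H)=\delta(G)+\delta(H)$.) *)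

(* Defs.v *)
From HB Require Import structures.
From mathcomp Require Import all_boot.

Set Implicit Arguments.
Unset Strict Implicit.
Unset Printing Implicit Defensive.

(* The vertex type may be empty, so that every vertex set of a graph can be
   deleted; being nonempty is part of [nontrivial]. *)
Record sgraph := SGraph {
  vertex :> finType;
  adj : rel vertex;
  adj_sym : symmetric adj;
  adj_irrefl : irreflexive adj }.

Definition nontrivial (G : sgraph) : bool := 1 < #|G|.

Definition connected (G : sgraph) : bool :=
  [forall x : G, forall y : G, connect (@adj G) x y].

Definition degree (G : sgraph) (x : G) : nat := #|[set y | adj x y]|.

(* Every degree is smaller than #|G|, so the default value of this minimum is
   reached only on the graph without vertices. *)
Definition min_degree (G : sgraph) : nat :=
  \big[minn/#|G|]_(x : G) degree x.

Section Deletion.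
Variables (G : sgraph) (S : {set G}).

Definition del_adj : rel {x : G | x \notin S} :=
  fun x y => adj (val x) (val y).

Lemma del_adj_sym : symmetric del_adj.
Proof. by move=> x y; rewrite /del_adj adj_sym. Qed.

Lemma del_adj_irrefl : irreflexive del_adj.
Proof. by move=> x; rewrite /del_adj adj_irrefl. Qed.

Definition del_vertices : sgraph := SGraph del_adj_sym del_adj_irrefl.

End Deletion.

(* [connected] holds on the graph without vertices, so S = [set: G] is not
   counted here. *)
Definition disconnecting (G : sgraph) (S : {set G}) : bool :=
  ~~ connected (del_vertices S) || (#|del_vertices S| == 1).

(* If G has a vertex, deleting all vertices but one is always allowed, so the
   default value of this minimum is reached only when G has no vertices. *)
Definition connectivity (G : sgraph) : nat :=
  \big[minn/#|G|]_(S : {set G} | disconnecting S) #|S|.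

Definition maximally_connected (G : sgraph) : Prop :=
  connectivity G = min_degree G.

Section Exponential.
Variables G H : sgraph.

(* The tuple (u_1, ..., u_q) is indexed by the vertices w_1, ..., w_q of H
   themselves: the coordinate u_j is u w_j. *)
Definition exp_adj : rel ({ffun H -> G} * H) :=
  fun a b =>
    let: (u, j) := a in
    let: (v, k) := b in
    [&& j == k, adj (u j) (v j) & [forall i, (i != j) ==> (u i == v i)]]
    || [&& j != k, adj j k & u == v].

Lemma exp_adj_sym : symmetric exp_adj.
Proof.
move=> [u j] [v k] /=.
rewrite [k == j]eq_sym [adj k j]adj_sym [v == u]eq_sym.
congr (_ || _); case: (eqVneq j k) => //= <-.
rewrite adj_sym; congr (_ && _).
by apply: eq_forallb => i; rewrite [v i == _]eq_sym.
Qed.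

Lemma exp_adj_irrefl : irreflexive exp_adj.
Proof. by move=> [u j] /=; rewrite adj_irrefl eqxx. Qed.

Definition exp_graph : sgraph := SGraph exp_adj_sym exp_adj_irrefl.

End Exponential.

(* Main.v *)
(** Let S be a set of fewer than delta(G) + delta(H) vertices.  The graph G^H is
    partitioned into copies of H (one for each u) and into copies of G.  The
    neighbours of a vertex x outside S lie in delta(G) + delta(H) or more
    pairwise disjoint copies, so x reaches a copy that avoids S; from a copy of
    G one similarly reaches a copy of H that avoids S.  Contracting the copies
    of H turns G^H into the Cartesian power of G indexed by V(H), in which S
    meets at most (#|H| - 1) delta(G) points; such a set cannot separate the
    Cartesian power, so all S-free copies of H lie in one component. *)
Require Import Defs.
From HB Require Import structures.
From mathcomp Require Import all_boot order zify.

Set Implicit Arguments.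
Unset Strict Implicit.
Unset Printing Implicit Defensive.

(** * Pigeonhole for disjoint families, and walks that avoid a vertex set *)

Lemma disjoint_family_avoids (I V : finType) (A : {set I}) (F : I -> pred V)
    (S : {set V}) :
  #|S| < #|A| ->
  (forall i i' x, i \in A -> i' \in A -> F i x -> F i' x -> i = i') ->
  exists2 i, i \in A & forall x, F i x -> x \notin S.
Proof.
move=> ltSA disjF.
case: (boolP [exists i in A, [forall x, F i x ==> (x \notin S)]]).
  case/exists_inP=> i Ai /forallP Fi; exists i => // x.
  exact: implyP (Fi x).
(* Otherwise every [F i] with [i] in [A] meets [S]. Picking one common point for each [i] injects
   [A] into [S] by disjointness, against [ltSA]. *)
move=> /exists_inPn hit; exfalso.
have {}hit i : i \in A -> {x | F i x & x \in S}.
  move=> /hit; rewrite negb_forall => /existsP ex.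
  apply: sig2W; case: ex => x; rewrite negb_imply negbK => /andP[Fx Sx].
  by exists x.
have [/set0Pn[i0 Ai0]|] := boolP (A != set0); last first.
  by rewrite negbK => /eqP A0; move: ltSA; rewrite A0 cards0 ltn0.
have [x0 _ _] := hit i0 Ai0.
pose f i := odflt x0 [pick x | F i x && (x \in S)].
have fP i : i \in A -> F i (f i) /\ f i \in S.
  move=> Ai; rewrite /f; case: pickP => [x /andP[]//|/=].
  by have [x Fx Sx] := hit i Ai; move/(_ x); rewrite Fx Sx.
have injf : {in A &, injective f}.
  move=> i i' Ai Ai' eqf; have [Fi _] := fP i Ai; have [Fi' _] := fP i' Ai'.
  by apply: (disjF _ _ (f i)) => //; rewrite eqf.
move: ltSA; rewrite -(card_in_imset injf) ltnNge => /negP; apply.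
by apply/subset_leq_card/subsetP => _ /imsetP[i Ai ->]; have [] := fP i Ai.
Qed.

(** Edges may go to walks, because an edge of the Cartesian power will be lifted to a walk through
    two copies of [H]. *)
Lemma connect_hom (U V : finType) (e : rel U) (e' : rel V) (f : U -> V) :
  (forall x y, e x y -> connect e' (f x) (f y)) ->
  forall x y, connect e x y -> connect e' (f x) (f y).
Proof.
move=> hom x y /connectP[p]; elim: p x => [|z p IHp] x /=; first by move=> _ ->.
by case/andP=> /hom exz /IHp zy /zy; apply: connect_trans.
Qed.

(** Deletion of [S] expressed on the full vertex type, so that walks need not be handled in the
    sigma type of [del_vertices]. *)
Definition avoiding (V : finType) (e : rel V) (S : {set V}) : rel V :=
  fun x y => [&& x \notin S, y \notin S & e x y].

Lemma avoiding_connect_sym (V : finType) (e : rel V) (S : {set V}) :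
  symmetric e -> connect_sym (avoiding e S).
Proof.
by move=> sym_e; apply: sym_connect_sym => x y; rewrite /avoiding sym_e andbCA.
Qed.

Lemma connectedP (G : sgraph) :
  reflect (forall x y : G, connect (@adj G) x y)
    (connected G).
Proof. by apply: (iffP forallP) => c x; apply/forallP/c. Qed.

(** * Minimum degree and bounds on the connectivity *)

Section Graphs.
Variable G : sgraph.

Lemma min_degree_le (x : G) : min_degree G <= degree x.
Proof. rewrite /min_degree -minEnat; exact: (@Order.TotalTheory.bigmin_le _ nat). Qed.

Lemma degree_lt_card (x : G) : degree x < #|G|.
Proof.
rewrite /degree -cardsT; apply: proper_card; rewrite properT.
by apply/negP=> /eqP/setP/(_ x); rewrite !inE adj_irrefl.
Qed.

Lemma min_degree_attained (x0 : G) : {x : G | degree x = min_degree G}.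
Proof.
rewrite /min_degree -minEnat.
have [//||x _ ->] := @Order.TotalTheory.eq_bigmin _ nat G #|G| x0 xpredT (@degree G).
  by move=> x _; apply/ltnW/degree_lt_card.
by exists x.
Qed.

Lemma min_degree_lt_card (x0 : G) : min_degree G < #|G|.
Proof. exact: leq_ltn_trans (min_degree_le x0) (degree_lt_card x0). Qed.

Lemma connected_degree_gt0 (x : G) : nontrivial G -> connected G -> 0 < degree x.
Proof.
rewrite /nontrivial => /card_gt1P[a [b [_ _ neq_ab]]] /connectedP conG.
have [y neq_yx] : exists y, y != x.
  by have [eax|] := eqVneq a x; [exists b; rewrite -eax eq_sym|exists a].
have /connectP[[|z p] /=] := conG x y; first by move=> _ eyx; rewrite eyx eqxx in neq_yx.
by case/andP=> xz _ _; rewrite card_gt0; apply/set0Pn; exists z; rewrite inE.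
Qed.

Lemma connected_min_degree_gt0 :
  nontrivial G -> connected G -> 0 < min_degree G.
Proof.
move=> ntG conG; have /card_gt0P[x0 _] := ltnW ntG.
have [x <-] := min_degree_attained x0; exact: connected_degree_gt0.
Qed.

Lemma connectivity_le (S : {set G}) : disconnecting S -> connectivity G <= #|S|.
Proof.
by rewrite /connectivity -minEnat; apply: (@Order.TotalTheory.bigmin_le_cond _ nat).
Qed.

Lemma connectivity_ge k :
  k <= #|G| -> (forall S : {set G}, disconnecting S -> k <= #|S|) ->
  k <= connectivity G.
Proof.
rewrite /connectivity -minEnat => leG leS.
exact/(@Order.TotalTheory.bigmin_geP _ nat).
Qed.

(** Deleting its neighbours isolates [x]: if what remains is connected, then [x] is the only vertex
    left. *)
Lemma disconnecting_neighbours (x : G) : disconnecting [set y | adj x y].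
Proof.
set S := [set y | adj x y]; rewrite /disconnecting.
have Sx : x \notin S by rewrite inE adj_irrefl.
pose x' : del_vertices S := exist _ x Sx.
have isol z : connect (@adj (del_vertices S)) x' z -> z = x'.
  case/connectP=> [[|y p] /= ]; first by [].
  by case/andP=> xy; move: (valP y); rewrite inE [adj _ _]xy.
have [con|//] := connectedP (del_vertices S).
have -> : #|del_vertices S| = #|pred1 x'|; last by rewrite card1.
apply: eq_card => z; rewrite !inE; apply/esym/eqP/isol/con.
Qed.

Lemma connectivity_le_min_degree (x0 : G) : connectivity G <= min_degree G.
Proof.
have [x <-] := min_degree_attained x0.
exact/connectivity_le/disconnecting_neighbours.
Qed.

Lemma connected_del_vertices (S : {set G}) :
  (forall x y : G, x \notin S -> y \notin S ->
     connect (avoiding (@adj G) S) x y) ->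
  connected (del_vertices S).
Proof.
move=> con; apply/connectedP=> x y.
case/connectP: (con (val x) (val y) (valP x) (valP y)) => p.
elim: p x => [|z p IHp] x /=; first by move=> _ /val_inj->.
case/andP=> /and3P[_ Sz xz] zp lst.
apply: (connect_trans (connect1 (_ : adj x (exist _ z Sz)))); first exact: xz.
exact: IHp.
Qed.

(** The cardinality hypothesis leaves at least two vertices, which rules out the one-vertex case of
    [disconnecting]. *)
Lemma not_disconnecting (S : {set G}) :
  #|S|.+1 < #|G| ->
  (forall x y : G, x \notin S -> y \notin S ->
     connect (avoiding (@adj G) S) x y) ->
  ~~ disconnecting S.
Proof.
move=> ltS /connected_del_vertices con; rewrite /disconnecting con /=.
have -> : #|del_vertices S| = #|~: S|.
  by rewrite card_sig; apply: eq_card => x; rewrite !inE.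
by have := cardsC S; lia.
Qed.

End Graphs.

(** * Cartesian powers of a graph and their subcubes *)

Section CartesianPower.
Variables (I : finType) (G : sgraph).
Implicit Types (u v w : {ffun I -> G}) (D : {set I}) (T : {set {ffun I -> G}}).

Definition upd u j g : {ffun I -> G} := [ffun i => if i == j then g else u i].

Lemma updE u j g i : upd u j g i = if i == j then g else u i.
Proof. by rewrite ffunE. Qed.

Lemma upd_eq u j g : upd u j g j = g.
Proof. by rewrite updE eqxx. Qed.

Lemma upd_upd u j g g' : upd (upd u j g) j g' = upd u j g'.
Proof. by apply/ffunP=> i; rewrite !updE; case: eqP. Qed.

Lemma upd_id u j : upd u j (u j) = u.
Proof. by apply/ffunP=> i; rewrite !updE; case: eqP => // ->. Qed.

Lemma upd_inj u j : injective (upd u j).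
Proof. by move=> g g' /(congr1 (fun u : {ffun I -> G} => u j)); rewrite !upd_eq. Qed.

Definition power_adj : rel {ffun I -> G} :=
  fun u v => [exists j, adj (u j) (v j) && (v == upd u j (v j))].

Lemma power_adj_upd u j g g' :
  adj g g' -> power_adj (upd u j g) (upd u j g').
Proof. by move=> gg'; apply/existsP; exists j; rewrite !upd_eq gg' upd_upd /=. Qed.

Lemma power_adj_sym : symmetric power_adj.
Proof.
suff sub u v : power_adj u v -> power_adj v u.
  by move=> u v; apply/idP/idP; apply: sub.
case/existsP=> j /andP[uv /eqP ev]; apply/existsP; exists j.
by rewrite adj_sym uv ev upd_upd upd_id eqxx.
Qed.

(** The copy through [v] of the Cartesian power of [G] indexed by [D]. *)
Definition cube v D := [set w : {ffun I -> G} | [forall (i | i \notin D), w i == v i]].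

Lemma cubeP v D w : reflect (forall i, i \notin D -> w i = v i) (w \in cube v D).
Proof. by rewrite inE; apply: (iffP forall_inP) => c i /c => [/eqP|->]. Qed.

Lemma cube_refl v D : v \in cube v D.
Proof. exact/cubeP. Qed.

Lemma upd_cube v D w j g : j \in D -> w \in cube v D -> upd w j g \in cube v D.
Proof.
move=> Dj /cubeP wP; apply/cubeP=> i Di; rewrite updE wP //.
by case: eqP Di => // ->; rewrite Dj.
Qed.

Lemma cubeS v D D' : D' \subset D -> cube v D' \subset cube v D.
Proof.
move=> /subsetP sub; apply/subsetP=> w /cubeP wP; apply/cubeP=> i Di.
by apply: wP; apply: contra Di; apply: sub.
Qed.

Lemma cube_eq v D w : w \in cube v D -> cube w D = cube v D.
Proof.
move=> /cubeP wP; apply/setP=> x; apply/cubeP/cubeP=> xP i Di.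
  by rewrite xP // wP.
by rewrite xP // wP.
Qed.

Lemma cube0 v w : w \in cube v set0 -> w = v.
Proof. by move=> /cubeP wP; apply/ffunP=> i; rewrite wP ?inE. Qed.

Lemma card_cube v D : #|cube v D| = #|G| ^ #|D|.
Proof.
pose F i : pred G := if i \in D then predT else pred1 (v i).
have -> : #|cube v D| = #|family F|.
  apply: eq_card => w; apply/cubeP/familyP => [wP i|wF i /negbTE Di].
    by rewrite unfold_in /F; case: ifP => // /negbT Di; rewrite /= wP.
  by have := wF i; rewrite unfold_in /F Di => /eqP.
rewrite card_family foldrE big_map big_enum /=.
rewrite (bigID (mem D)) /= [X in _ * X]big1 ?muln1; last first.
  by move=> i /negbTE Di; rewrite /F Di card1.
rewrite (eq_bigr (fun=> #|G|)); first by rewrite prod_nat_const.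
by move=> i Di; rewrite /F Di; apply: eq_card.
Qed.

(** With [n = #|G|], the right side counts the lines of one direction in a cube of dimension
    [m + 1], and the left side bounds the deleted points there. *)
Lemma ltn_mul_exp n d m : d < n -> m * d < n ^ m.
Proof.
move=> ltdn; elim: m => [|m IHm]; first by [].
rewrite expnS; nia.
Qed.

End CartesianPower.

(** * Deleting few points from a Cartesian power *)

Section PowerConnectivity.
Variables (I : finType) (G : sgraph) (d : nat).
Hypotheses (conG : connected G) (degG : forall g : G, d <= degree g).
Implicit Types (u v w : {ffun I -> G}) (D : {set I}) (T : {set {ffun I -> G}}).

Lemma line_connect T v j :
  (forall g, upd v j g \notin T) ->
  forall g g', connect (avoiding (@power_adj I G) T) (upd v j g) (upd v j g').
Proof.
move=> clean g g'; apply: (connect_hom (e := @adj G)); last exact/connectedP.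
move=> h h' hh'; apply: connect1.
by rewrite /avoiding !clean power_adj_upd.
Qed.

(* A line in direction [j] avoids [T], and every point [x] of the cube reaches
   that line: either the layer of [x] (the points with the same [j]-coordinate)
   is covered by induction, or so much of [T] lies in it that some adjacent
   layer is free of [T]. *)
Lemma cube_connect T D v w :
  #|T :&: cube v D| <= #|D|.-1 * d -> w \in cube v D ->
  v \notin T -> w \notin T ->
  connect (avoiding (@power_adj I G) T) v w.
Proof.
have [m] := ubnP #|D|; elim: m => // m IHm in D v w *.
rewrite ltnS => leDm leT vw vT wT.
have [D0|/set0Pn[j Dj]] := eqVneq D set0.
  by move: vw; rewrite D0 => /cube0->.
pose D' := D :\ j.
have cardD : #|D| = #|D'|.+1 by rewrite (cardsD1 j D) Dj.
have ltdG : d < #|G| := leq_ltn_trans (degG (v j)) (degree_lt_card (v j)).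
have subD' x : x \in cube v D -> cube x D' \subset cube v D.
  by move=> vx; rewrite -(cube_eq vx); apply/cubeS/subD1set.
(* Lines in direction [j] are indexed by the points of [cube v D']: [x] lies on the line of [y] when
   resetting its [j]-coordinate to [v j] gives [y]. There are more lines than points of [T] in the
   cube. *)
have [y vy clean] : exists2 y, y \in cube v D' & forall g, upd y j g \notin T.
  have [|y y' x /cubeP yD /cubeP y'D /eqP<- /eqP eqy|y vy clean] :=
    @disjoint_family_avoids _ _ (cube v D') (fun y x => upd x j (v j) == y)
      (T :&: cube v D).
  - rewrite card_cube; apply: leq_ltn_trans leT _.
    by rewrite cardD /= ltn_mul_exp.
  - by [].
  exists y => // g; have := clean (upd y j g).
  have yj : y j = v j by apply: (cubeP _ _ _ vy); rewrite !inE eqxx.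
  rewrite upd_upd -yj upd_id eqxx => /(_ isT).
  rewrite in_setI upd_cube ?andbT //.
  by apply: (subsetP (subD' v (cube_refl v D))).
have layer x g : x \in cube v D -> x j = g -> upd y j g \in cube x D'.
  move=> /cubeP xP <-; apply/cubeP=> i; rewrite !inE updE negb_and negbK.
  case: eqVneq => [->//|ij /= Di].
  by rewrite xP //; apply: (cubeP _ _ _ vy); rewrite !inE ij.
have leD'm : #|D'| < m by rewrite -cardD.
have to_line x : x \in cube v D -> x \notin T ->
    exists g, connect (avoiding (@power_adj I G) T) x (upd y j g).
  move=> vx xT; have [leTx|gtTx] := leqP #|T :&: cube x D'| (#|D'|.-1 * d).
    by exists (x j); apply: (IHm D'); rewrite // layer.
  have [||g xg free] := @disjoint_family_avoids _ _ [set g | adj (x j) g]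
      (fun g (z : {ffun I -> G}) => (z j == g) && (z \in cube v D))
      ((T :&: cube v D) :\: cube x D').
  - have cardT := cardsID (cube x D') (T :&: cube v D).
    rewrite -setIA (setIidPr (subD' x vx)) in cardT; rewrite cardD /= in leT.
    (* If more than [(p - 1) * d] of at most [p * d] deleted points lie in the layer of [x], fewer
       than [d] lie outside it, so some neighbouring layer escapes them. *)
    have arith a b c e p : b <= p * d -> p.-1 * d < a -> d <= e -> a + c = b -> c < e.
      by case: p => [|p] /=; rewrite ?mul0n ?mulSn; lia.
    exact: arith leT gtTx (degG (x j)) cardT.
  - by move=> g g' z _ _ /andP[/eqP<- _] /andP[/eqP<-].
  rewrite inE in xg; pose x' := upd x j g.
  (* The points of [T] in the layer of [x] were left out of the count; [z] is not among them, as
     [z j] is adjacent to [x j]. *)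
  have freeT z : z \in cube v D -> z j = g -> z \notin T.
    move=> vz zg; have := free z; rewrite zg eqxx vz => /(_ isT).
    rewrite in_setD in_setI vz andbT negb_and negbK => /orP[/cubeP zx|//].
    move: xg; rewrite -zg zx ?adj_irrefl //.
    by rewrite !inE eqxx.
  have vx' : x' \in cube v D by apply: upd_cube.
  have x'T : x' \notin T by apply: freeT; rewrite ?upd_eq.
  exists g; apply: (connect_trans (y := x')).
    apply: connect1; rewrite /avoiding xT x'T /=.
    by rewrite -{1}(upd_id x j) power_adj_upd.
  apply: (IHm D'); rewrite ?layer ?upd_eq //.
  have -> : T :&: cube x' D' = set0.
    apply/setP=> z; rewrite in_setI in_set0; apply/negP=> /andP[zT x'z].
    have zg : z j = g by rewrite (cubeP _ _ _ x'z) ?upd_eq // !inE eqxx.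
    by move: (freeT z (subsetP (subD' x' vx') z x'z) zg); rewrite zT.
  by rewrite cards0.
have [g vg] := to_line v (cube_refl v D) vT; have [g' wg'] := to_line w vw wT.
apply: connect_trans vg (connect_trans (line_connect clean g g') _).
by rewrite (avoiding_connect_sym T (@power_adj_sym I G)).
Qed.

End PowerConnectivity.

(** * Adjacency and degrees in the exponential graph *)

Section ExponentialDegree.
Variables G H : sgraph.
Implicit Types (u v : {ffun H -> G}) (j k : H).

Lemma exp_adj_upd u j g g' :
  adj g g' -> @adj (exp_graph G H) (upd u j g, j) (upd u j g', j).
Proof.
move=> gg'; rewrite /= !upd_eq eqxx gg' /=; apply/orP; left.
by apply/forall_inP=> i /negbTE ij; rewrite !updE ij.
Qed.

Lemma exp_adj_snd u j k : adj j k -> @adj (exp_graph G H) (u, j) (u, k).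
Proof.
move=> jk; rewrite /= jk eqxx /=; apply/orP; right; rewrite andbT.
by apply: contraTneq jk => ->; rewrite adj_irrefl.
Qed.

Lemma exp_adjP u j (y : exp_graph G H) :
  reflect ((exists2 g, adj (u j) g & y = (upd u j g, j)) \/
           (exists2 k, adj j k & y = (u, k)))
          (@adj (exp_graph G H) (u, j) y).
Proof.
apply: (iffP idP) => [|[[g ug ->]|[k jk ->]]]; last 2 first.
- by have := exp_adj_upd u j ug; rewrite upd_id.
- exact: exp_adj_snd.
case: y => v k /= /orP[/and3P[/eqP <- uv /forall_inP agree]|]; last first.
  by case/and3P=> _ jk /eqP<-; right; exists k.
left; exists (v j) => //; congr (_, _); apply/ffunP=> i.
by rewrite updE; case: eqVneq => [->//|/agree/eqP].
Qed.

Lemma degree_exp u j :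
  @degree (exp_graph G H) (u, j) = degree (u j) + degree j.
Proof.
pose f g : exp_graph G H := (upd u j g, j).
pose h k : exp_graph G H := (u, k).
have injf : injective f by move=> g g' [/upd_inj].
have injh : injective h by move=> k k' [].
rewrite /degree -(card_imset _ injf) -(card_imset _ injh).
set A := f @: _; set B := h @: _.
have disj : A :&: B = set0.
  apply/setP=> y; rewrite in_setI in_set0; apply/negP.
  case/andP=> /imsetP[g _ ->] /imsetP[k]; rewrite inE => jk [_ ejk].
  by rewrite ejk adj_irrefl in jk.
rewrite -cardsUI disj cards0 addn0.
apply: eq_card => y; rewrite inE in_setU; apply/exp_adjP/orP.
  case=> [[g ug ->]|[k jk ->]]; first by left; apply: imset_f; rewrite inE.
  by right; apply: imset_f; rewrite inE.
case=> /imsetP[z]; rewrite inE => az ->; first by left; exists z.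
by right; exists z.
Qed.

Lemma min_degree_exp (g0 : G) (j0 : H) :
  min_degree (exp_graph G H) = min_degree G + min_degree H.
Proof.
apply/eqP; rewrite eqn_leq; apply/andP; split.
  (* A constant tuple has a coordinate of least degree at every position. *)
  have [g <-] := min_degree_attained g0; have [j <-] := min_degree_attained j0.
  have := @min_degree_le (exp_graph G H) ([ffun=> g], j).
  by rewrite degree_exp ffunE.
have [[u j] <-] := @min_degree_attained (exp_graph G H) ([ffun=> g0], j0).
by rewrite degree_exp leq_add ?min_degree_le.
Qed.

End ExponentialDegree.

(** * Deleting few vertices from the exponential graph *)

Section ExponentialConnectivity.
Variables (G H : sgraph) (S : {set exp_graph G H}).
Hypotheses (ntG : nontrivial G) (ntH : nontrivial H).
Hypotheses (conG : connected G) (conH : connected H).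
Hypothesis ltS : #|S| < min_degree G + min_degree H.
Implicit Types (u v : {ffun H -> G}) (j k : H).

Local Notation conn := (connect (avoiding (@adj (exp_graph G H)) S)).

Let dG_gt0 : 0 < min_degree G. Proof. exact: connected_min_degree_gt0. Qed.
Let dH_gt0 : 0 < min_degree H. Proof. exact: connected_min_degree_gt0. Qed.

Definition free_H_copy u := forall j, (u, j) \notin S.
Definition free_G_copy u j := forall g, (upd u j g, j) \notin S.

Lemma free_H_copy_connect u j k : free_H_copy u -> conn (u, j) (u, k).
Proof.
move=> free; apply: (connect_hom (e := @adj H) (f := pair u)); last exact/connectedP.
move=> a b ab; apply: connect1; rewrite /avoiding !free; exact: exp_adj_snd.
Qed.

Lemma free_G_copy_connect u j g g' :
  free_G_copy u j -> conn (upd u j g, j) (upd u j g', j).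
Proof.
move=> free.
apply: (connect_hom (e := @adj G) (f := fun g => (upd u j g, j))); last exact/connectedP.
move=> a b ab; apply: connect1; rewrite /avoiding !free; exact: exp_adj_upd.
Qed.

(** Let [T] be the projection of [S] to tuples. A walk of the Cartesian power outside [T] lifts: to
    change coordinate [i], go from [j] to [i] in one copy of [H], change the coordinate, and return
    to [j] in the next copy. *)
Lemma free_H_copies_connect u v j :
  free_H_copy u -> free_H_copy v -> conn (u, j) (v, j).
Proof.
pose T := [set x.1 | x in S].
have notT w : w \notin T -> free_H_copy w.
  by move=> wT i; apply: contra wT => Sw; apply/imsetP; exists (w, i).
have freeT w : free_H_copy w -> w \notin T.
  by move=> free; apply/imsetP=> -[[w' i] Sx /= ew]; case/negP: (free i); rewrite ew.
move=> /freeT uT /freeT vT.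
have : connect (avoiding (@power_adj H G) T) u v.
  apply: (@cube_connect _ _ (min_degree G) conG _ T setT) => //.
  - exact: min_degree_le.
  - have leTS : #|T| <= #|S| := leq_imset_card _ _.
    apply: leq_trans (subset_leq_card (subsetIl _ _)) (leq_trans leTS _).
    rewrite cardsT; have := min_degree_lt_card j; move: ltS dG_gt0 dH_gt0.
    (* Here [e <= h], so [s <= d + h - 1], and this is at most [h * d] because [(h - 1) * (d - 1)]
       is nonnegative. *)
    case: #|H| => [//|h]; rewrite ltnS /=.
    move: #|S| (min_degree G) (min_degree H) => s d e; nia.
  - by apply/cubeP=> i; rewrite inE.
apply: connect_hom (fun w => (w, j)) _ _ _ => a b /and3P[/notT aF /notT bF].
case/existsP=> i /andP[ab /eqP eb].
apply: connect_trans (free_H_copy_connect j i aF) _.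
apply: connect_trans _ (free_H_copy_connect i j bF).
apply: connect1; rewrite /avoiding aF bF /= eb.
by have := exp_adj_upd a i ab; rewrite upd_id.
Qed.

(* The neighbours of [x] lie in pairwise disjoint copies of [H] or [G]. *)
Lemma connect_free_copy (x : exp_graph G H) :
  x \notin S ->
  (exists u j, free_H_copy u /\ conn x (u, j)) \/
  (exists u j, free_G_copy u j /\ conn x (u, j)).
Proof.
case: x => u j Sx.
(* [F y] is the copy through the neighbour [y] that does not contain [(u, j)]: a copy of [H] if [y]
   has position [j], a copy of [G] otherwise. *)
pose F (y z : exp_graph G H) :=
  if y.2 == j then z.1 == y.1 else (z.2 == y.2) && (z.1 == upd u y.2 (z.1 y.2)).
have [||y] := @disjoint_family_avoids _ _ [set y | @adj (exp_graph G H) (u, j) y] F S.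
- apply: leq_trans ltS _; have := degree_exp u j; rewrite /degree => ->.
  by apply: leq_add; apply: min_degree_le.
- have adjN k : adj j k -> (k == j) = false.
    by move=> jk; apply/eqP=> ek; rewrite ek adj_irrefl in jk.
  (* The left tuple differs from [u] at [j], while the right one can differ from [u] only at [k]. *)
  have clash g k w : adj (u j) g -> adj j k -> upd u j g = upd u k w -> False.
    move=> ug /adjN kj /(congr1 (fun f : {ffun H -> G} => f j)).
    by rewrite !updE eqxx eq_sym kj => eg; rewrite eg adj_irrefl in ug.
  move=> y y' [w l]; rewrite !inE => /exp_adjP[] [a ua ->] /exp_adjP[] [b ub ->];
    rewrite /F /= ?eqxx ?(adjN _ ua) ?(adjN _ ub).
  + by move=> /eqP-> /eqP->.
  + by move=> /eqP-> /andP[_ /eqP]/(clash _ _ _ ua ub).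
  + by move=> /andP[_ /eqP] + /eqP ew; rewrite ew => /(clash _ _ _ ub ua).
  + by move=> /andP[/eqP<- _] /andP[/eqP<- _].
rewrite inE => xy free.
have Sy : y \notin S by apply: free; rewrite /F; case: ifP; rewrite ?eqxx //=;
  case/exp_adjP: xy => [[g _ ->]|[k _ ->]]; rewrite /= ?upd_id ?eqxx.
have cxy : conn (u, j) y by apply: connect1; rewrite /avoiding Sx Sy.
case/exp_adjP: xy => -[a ua ey]; rewrite ey in cxy Sy; move: free; rewrite ey /F /=.
  move=> free; left; exists (upd u j a), j; split=> // k.
  by apply: free; rewrite eqxx.
move=> free; right; exists u, a; split=> // g; apply: free.
case: eqVneq => [ea|_]; last by rewrite eqxx upd_eq /=.
by rewrite ea adj_irrefl in ua.
Qed.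

(* Leave the copy of [G] at a point with coordinate [g] towards a neighbour [k]
   of [j], then change coordinate [k]: over all [(g, k)] these detours, together
   with the copies of [H] they reach, are pairwise disjoint. *)
Lemma free_G_copy_connect_H u j :
  free_G_copy u j -> exists v k, free_H_copy v /\ conn (u, j) (v, k).
Proof.
move=> free.
have nbr k : {h | adj (u k) h}.
  apply: sigW; have := connected_degree_gt0 (u k) ntG conG.
  by rewrite card_gt0 => /set0Pn[h]; rewrite inE; exists h.
pose h k := sval (nbr k); have hP k : h k != u k.
  by apply/eqP=> eh; have := svalP (nbr k); rewrite -/(h k) eh adj_irrefl.
(* The vertex where the detour arrives at position [k], and the copy of [H] reached by then moving
   coordinate [k] to the fixed neighbour [h k] of [u k]. *)
pose F (i : G * H) (z : exp_graph G H) :=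
  (z == (upd u j i.1, i.2)) || (z.1 == upd (upd u j i.1) i.2 (h i.2)).
have [||[g k]] := @disjoint_family_avoids _ _ (setX setT [set k | adj j k]) F S.
(* There are at least [(min_degree G + 1) * min_degree H] pairs, hence at least
   [min_degree G + min_degree H]. *)
- rewrite cardsX cardsT; have : min_degree H <= #|[set k | adj j k]| := min_degree_le j.
  have := min_degree_lt_card (u j); move: ltS dG_gt0 dH_gt0; nia.
- have adjN k : adj j k -> (j == k) = false.
    by move=> jk; apply/eqP=> ek; rewrite -ek adj_irrefl in jk.
  move=> [a k] [b l] [w m]; rewrite !inE /= => jk jl.
  move: (adjN k jk) (adjN l jl) => njk njl.
  (* A detour changes only a coordinate other than [j] after leaving the copy of [G], so coordinate
     [j] recovers the first component of the index. *)
  have wj i c : w = upd u j c \/ w = upd (upd u j c) i (h i) ->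
      (j == i) = false -> w j = c.
    by case=> -> ji; rewrite !updE ?ji eqxx.
  rewrite /F /= => wa wb.
  have ea : w j = a.
    by apply: (wj k) => //; case/orP: wa => /eqP; [case; left|right].
  have eb : w j = b.
    by apply: (wj l) => //; case/orP: wb => /eqP; [case; left|right].
  have eab : a = b by rewrite -ea -eb.
  rewrite -eab in wb *; congr (_, _).
  (* The second component is recovered from [h i] being different from [u i]: only the coordinate of
     the index itself can have been moved. *)
  have neq c i : (j == i) = false -> (upd u j c == upd (upd u j c) i (h i)) = false.
    move=> ji; apply/eqP=> /(congr1 (fun f : {ffun H -> G} => f i)).
    rewrite !updE eqxx [i == j]eq_sym ji => /eqP; rewrite eq_sym; exact/negP.
  case/orP: wa => /eqP; [case=> ew em|move=> ew]; rewrite ew in wb.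
    rewrite em in wb; case/orP: wb => [/eqP[]|] //; by rewrite neq.
  case/orP: wb => [/eqP[e _]|]; first by move: (neq a k njk); rewrite -{1}e eqxx.
  apply: contraTeq => nkl; apply/eqP=> /(congr1 (fun f : {ffun H -> G} => f k)).
  rewrite !updE eqxx (negbTE nkl) [k == j]eq_sym njk => /eqP.
  exact/negP.
rewrite !inE /= => jk avoid.
pose w := upd u j g; pose v := upd w k (h k).
have vF : free_H_copy v by move=> l; apply: avoid; rewrite /F /= eqxx orbT.
have Swk : (w, k) \notin S by apply: avoid; rewrite /F /= eqxx.
exists v, k; split=> //.
apply: (connect_trans (y := (w, j))).
  by rewrite -{1}(upd_id u j); apply: free_G_copy_connect.
apply: (connect_trans (y := (w, k))); apply: connect1.
  by rewrite /avoiding free Swk; apply: exp_adj_snd.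
apply/and3P; split; [by []|exact: vF|]; apply/(exp_adjP w k (v, k)).
left; exists (h k) => //.
have -> : w k = u k; last exact: svalP (nbr k).
by rewrite updE; case: eqVneq jk => // ->; rewrite adj_irrefl.
Qed.

Lemma connect_free_H_copy (x : exp_graph G H) :
  x \notin S -> exists v k, free_H_copy v /\ conn x (v, k).
Proof.
case/connect_free_copy=> [//|[u [j [/free_G_copy_connect_H[v [k [vF cuv]]] cxu]]]].
by exists v, k; split=> //; apply: connect_trans cxu cuv.
Qed.

Lemma exp_connect_avoiding (x y : exp_graph G H) :
  x \notin S -> y \notin S -> conn x y.
Proof.
move=> /connect_free_H_copy[u [j [uF xu]]] /connect_free_H_copy[v [k [vF yv]]].
apply: connect_trans xu (connect_trans (free_H_copy_connect j k uF) _).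
apply: connect_trans (free_H_copies_connect k uF vF) _.
by rewrite (avoiding_connect_sym S (@adj_sym (exp_graph G H))).
Qed.

End ExponentialConnectivity.

Theorem theorem5 (G H : sgraph)
    (ntG : nontrivial G) (ntH : nontrivial H)
    (conG : connected G) (conH : connected H) :
  maximally_connected (exp_graph G H) /\
  connectivity (exp_graph G H) = min_degree G + min_degree H.
Proof.
have /card_gt0P[g0 _] := ltnW ntG; have /card_gt0P[j0 _] := ltnW ntH.
suff conE : connectivity (exp_graph G H) = min_degree G + min_degree H.
  by rewrite /maximally_connected conE (min_degree_exp g0 j0).
pose x0 : exp_graph G H := ([ffun=> g0], j0).
(* Used twice: against the default value in [connectivity], and to leave two vertices outside a
   small [S]. *)
have ltcard := min_degree_lt_card x0; rewrite (min_degree_exp g0 j0) in ltcard.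
apply/eqP; rewrite eqn_leq -{1}(min_degree_exp g0 j0) connectivity_le_min_degree //=.
apply: connectivity_ge => [|S]; first exact: ltnW.
apply: contraTleq => ltS; apply: not_disconnecting; first exact: leq_ltn_trans ltcard.
exact: exp_connect_avoiding.
Qed.
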